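(* For any integer $d>1$ and any $i\in\{1,\dots,n\}$, there exists a randomized algorithm in the adversarial comparator model (against an adaptive adversary) that, on $n$ input items, takes $d+O(\log d)$ rounds, makes $n^{1+O(1/d)}\,d\log n$ comparisons, and returns a $202$-approximate $i$-selection with probability $>1-\frac{1}{n^2}$.
   Context: Adversarial comparator model: we are given $n$ items with unknown real values, accessible only through a comparator which, given two items $x_i,x_j$, returns $\max\{x_i,x_j\}$ if $|x_i-x_j|>1$, and otherwise returns either one as chosen by an adversary; the adversary is adaptive (its choices may depend on previous queries and answers). In the round model, in each round the algorithm submits a set of comparisons, chosen based on answers of previous rounds, and receives all answers. For reals $a,b$ write $a\ge_k b$ if $a\ge b-k$. An ordering $y_1,\dots,y_n$ of the items is a $k$-approximate sorting if $y_j\ge_k y_i$ for all $j>i$. An item $x^*$ is a $k$-approximate $i$-selection if there is a $k$-approximate sorting $y_1,\dots,y_n$ with $y_i=x^*$ (equivalently, $|x^*-x_{(i)}|\le k$ where $x_{(i)}$ is the true $i$-th smallest value). *)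

(* Defs.v *)
From mathcomp Require Import all_boot all_order all_algebra all_fingroup.
From mathcomp Require Import reals exp.

Set Implicit Arguments.
Unset Strict Implicit.
Unset Printing Implicit Defensive.

Import Order.TTheory GRing.Theory Num.Theory.
Local Open Scope ring_scope.

Section Approximation.
Variables (R : realType) (n : nat).

Definition approx_ge (k a b : R) : bool := b - k <= a.

(* The ordering y_1, ..., y_n is given by a permutation s of the item
   indices, the j-th item in the ordering being s j (positions are 0-based). *)
Definition approx_sorting (k : R) (x : 'I_n -> R) (s : 'S_n) : bool :=
  [forall i : 'I_n, forall j : 'I_n,
     (i < j)%N ==> approx_ge k (x (s j)) (x (s i))].

Definition approx_selection (k : R) (x : 'I_n -> R) (i r : 'I_n) : bool :=
  [exists s : 'S_n, approx_sorting k x s && (s i == r)].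

End Approximation.

Section Model.
Variables (R : realType) (n : nat).

Definition comparison := ('I_n * 'I_n)%type.

(* The answers to one round: the winner for each submitted comparison and
   None for the others, so that nothing is revealed about pairs that were not
   submitted and the submitted set can be read off the answers. *)
Definition round_answers := {ffun comparison -> option 'I_n}.

Definition history := seq round_answers.

(* The adversary sees the previous rounds and the whole current set of
   comparisons, but not the algorithm's random seed. Its bit for a comparison
   (a, b), where true means a, is used only when a and b are within
   distance 1. *)
Definition adversary := history -> {set comparison} -> comparison -> bool.

Definition comparator (x : 'I_n -> R) (bit : bool) (p : comparison) : 'I_n :=
  if 1 < `|x p.1 - x p.2| then (if x p.1 < x p.2 then p.2 else p.1)
  else (if bit then p.1 else p.2).

Definition answer (x : 'I_n -> R) (adv : adversary) (h : history)
    (Q : {set comparison}) : round_answers :=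
  [ffun p => if p \in Q then Some (comparator x (adv h Q p) p) else None].

(* All randomness is drawn up front as a seed. Finite seed spaces lose no
   generality: for fixed n and a fixed number of rounds there are only finitely
   many deterministic algorithms. *)
Record rand_algorithm := RandAlgorithm {
  seed : finType;
  prob : seed -> R;
  prob_ge0 : forall w, 0 <= prob w;
  prob_sum1 : \sum_w prob w = 1;
  rounds : nat;
  query : seed -> history -> {set comparison};
  output : seed -> history -> 'I_n
}.

Variables (A : rand_algorithm) (x : 'I_n -> R) (adv : adversary).

Fixpoint run (w : seed A) (t : nat) : history :=
  if t is t'.+1 then
    let h := run w t' in rcons h (answer x adv h (query w h))
  else [::].

Definition num_comparisons (w : seed A) : nat :=
  (\sum_(t < rounds A) #|query w (run w t)|)%N.

Definition result (w : seed A) : 'I_n := output w (run w (rounds A)).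

Definition Pr (E : pred (seed A)) : R := \sum_(w | E w) prob w.

End Model.

(* Main.v *)
Require Import Defs.
From mathcomp Require Import all_boot all_order all_algebra all_fingroup.
From mathcomp Require Import reals sequences exp.
From mathcomp Require Import zify ring lra.

(* Let v be the true i-th smallest value. Every round splits the undecided
   items at random into bins and compares all pairs inside each bin, and the
   items of bin 0, the pivots, with all n items. Counting its victories tells
   for each pivot p whether p <= v + 1 (a lo pivot) or p >= v - 1 (a hi pivot).
   Let U be the largest lo pivot and V the smallest hi pivot found so far.

   By a Chernoff bound every initial or final segment of the undecided items is
   spread evenly over the bins, up to an error e. An item above U + 1 beats all
   items below U in its own bin, hence at least (number of lo pivots) - e of
   them; an item with fewer victories lies below U + 1 and is put aside as low.
   Symmetrically, an item with too few defeats lies above V - 1 and is put aside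
   as high. Evenness is a property of the partition alone, so it does not matter
   that the adversary sees the partition before answering.

   If V > U + 1, few items of a bin lie strictly between U and V, and since a
   tournament has few players with almost the maximal score, only O(e) items
   per bin stay undecided: the undecided set shrinks by a factor m of order
   n^(1/d). If V <= U + 1, both U and V are within 2 of v and later rounds do
   not matter. In the end, if there are more than i low items then v <= U + 1
   and a king of the tournament on the lo pivots is returned, which is within 2
   of U; otherwise v >= V - 1 and the hi pivots are used in the same way. *)

Set Implicit Arguments.
Unset Strict Implicit.
Unset Printing Implicit Defensive.
Import Order.TTheory GRing.Theory Num.Theory.
Local Open Scope ring_scope.

(** * Kings and near-maximal scores in tournaments *)

Section Tournaments.
Variables (T : finType) (B : rel T).
Local Open Scope nat_scope.

(** A player [a] of maximal score works: a [b] not reached in two steps would beat [a] and everyone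
    in [P] that [a] beats, so it would score more. *)
Lemma king_exists (P : {set T}) :
  {in P &, forall a b, a != b -> B a b || B b a} -> P != set0 ->
  exists2 a, a \in P &
    {in P, forall b, [|| a == b, B a b | [exists c, B a c && B c b]]}.
Proof.
move=> tot /set0Pn[p0 Pp0].
pose N a := [set c in P | (c != a) && B a c].
have [a Pa maxa] := @arg_maxnP _ p0 (mem P) (fun a => #|N a|) Pp0.
have {}Pa : a \in P by []; exists a => // b Pb; apply: contraT; rewrite !negb_or => /and3P[ab nBab].
rewrite negb_exists => /forallP nBB.
have /(leq_trans _) : #|a |: N a| <= #|N b|.
  apply/subset_leq_card/subsetP => c; rewrite !inE => /orP[/eqP->|].
    by rewrite Pa ab; move: (tot _ _ Pa Pb ab); rewrite (negPf nBab).
  move=> /and3P[Pc ca Bac]; have cb : c != b by apply: contraNneq nBab => <-.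
  rewrite Pc cb; have := tot _ _ Pc Pb cb.
  by have := nBB c; rewrite Bac /= => /negPf->.
move=> /(_ _ (leqnn _)); rewrite cardsU1 !inE eqxx /= andbF add1n.
by rewrite ltnNge (maxa b Pb : #|N b| <= #|N a|).
Qed.

(** Double counting: the wins inside [X] total at most half of [#|X| ^ 2], and each member has at
    most [#|Z| - #|X|] wins in the rest of [Z]; average over [X]. *)
Lemma high_score_card (Z X : {set T}) (q c : nat) :
  (forall a b, B a b -> ~~ B b a) -> X \subset Z ->
  {in X, forall y, q <= #|[set z in Z | B y z]| + c} ->
  #|X| + q.*2 <= (#|Z| + c).*2 \/ #|X| = 0.
Proof.
move=> asym XZ qle; case: (posnP #|X|) => [|X0]; [by right|left].
set u := #|X| in X0 *.
have uZ : u <= #|Z| by exact: subset_leq_card.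
have le1 y : y \in X ->
    q <= \sum_(z in X) (B y z : nat) + (#|Z| - u) + c.
  move=> Xy; apply: leq_trans (qle y Xy) _; rewrite leq_add2r.
  have -> : #|[set z in Z | B y z]| =
      #|[set z in X | B y z]| + #|[set z in Z :\: X | B y z]|.
    rewrite -(cardsID X); congr (_ + _); apply: eq_card => z; rewrite !inE.
      by case: (boolP (z \in X)) => [/(subsetP XZ)->|]; rewrite ?andbT ?andbF.
    by rewrite andbA.
  apply: leq_add.
    rewrite -sum1dep_card -big_mkcondr /=; apply: eq_leq.
    by apply: eq_big => // z; case: (B y z).
  have -> : #|Z| - u = #|Z :\: X| by rewrite cardsDS.
  by apply/subset_leq_card/subsetP => z; rewrite !inE => /andP[].
have half : (\sum_(y in X) \sum_(z in X) (B y z : nat)).*2 <= u * u.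
  rewrite -addnn {2}exchange_big -big_split /=.
  apply: (@leq_trans (\sum_(y in X) u)); last by rewrite sum_nat_const.
  apply: leq_sum => y _; rewrite -big_split /=.
  apply: (@leq_trans (\sum_(z in X) 1)); last by rewrite sum1_card.
  apply: leq_sum => z _; have := asym y z; have := asym z y.
  by case: (B y z); case: (B z y) => // /(_ isT).
have tot : u * q <=
    \sum_(y in X) \sum_(z in X) (B y z : nat) + u * (#|Z| - u) + u * c.
  rewrite -sum_nat_const -[u * (_ - _)]sum_nat_const -[u * c]sum_nat_const.
  by rewrite -!big_split /=; apply: leq_sum => y; apply: le1.
rewrite -(leq_pmul2l X0).
move: tot half uZ X0; set s := \sum_(_ in _) _; nia.
Qed.

End Tournaments.

(** * The target value and its rank bounds *)

Section OrderStatistics.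
Variables (R : realType) (n : nat) (x : 'I_n -> R) (i : 'I_n).

Lemma sorting_perm_exists :
  exists s : 'S_n, forall a b : 'I_n, (a <= b)%N -> x (s a) <= x (s b).
Proof.
pose r := relpre x <=%R; pose t := sort r (enum 'I_n).
have tn : size t = n by rewrite size_sort size_enum_ord.
have ut : uniq t by rewrite sort_uniq enum_uniq.
have finj : injective (fun a : 'I_n => nth i t a).
  move=> a b /eqP; rewrite nth_uniq ?tn // => /eqP ab; exact: val_inj.
exists (perm finj) => a b ab; rewrite !permE.
have rtr : transitive r by move=> p q u /=; apply: le_trans.
apply: (sorted_leq_nth rtr _ i (sort_sorted _ _)); rewrite ?inE ?tn ?ltn_ord //.
- by move=> p /=.
- by move=> p q; apply: le_total.
Qed.

Lemma card_ord_ltn (m : nat) : (m <= n)%N -> #|[set j : 'I_n | (j < m)%N]| = m.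
Proof. 
by move=> mn; rewrite -sum1dep_card big_ord_narrow // big_const_ord iter_addn mul1n addn0.
Qed.

(** [v] is the entry at position [i] of a sorted order; later arguments know it only through these
    three properties. *)
Lemma order_statistic_exists :
  exists v : R,
  [/\ forall (E : {set 'I_n}) (th : R), (i < #|E|)%N ->
        {in E, forall y, x y <= th} -> v <= th,
      forall (E : {set 'I_n}) (th : R), (n <= #|E| + i)%N ->
        {in E, forall y, th <= x y} -> th <= v &
      forall r, `|x r - v| <= 4%:R -> approx_selection 202%:R x i r].
Proof.
have [s mono] := sorting_perm_exists; exists (x (s i)); split.
- move=> E th iE Eth.
  have [y yE yi] : exists2 y, y \in E & (i <= (s^-1)%g y)%N.
    apply/exists_inP; apply: contraLR iE; rewrite negb_exists_in => /forall_inP h.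
    rewrite -leqNgt -(card_imset E (@perm_inj _ s^-1%g)).
    rewrite -[X in (_ <= X)%N](card_ord_ltn (ltnW (ltn_ord i))).
    apply/subset_leq_card/subsetP => _ /imsetP[y yE ->].
    by rewrite inE ltnNge h.
  by apply: le_trans (Eth y yE); rewrite -[in leRHS](permKV s y) mono.
- move=> E th iE Eth.
  have [y yE yi] : exists2 y, y \in E & ((s^-1)%g y <= i)%N.
    apply/exists_inP; apply: contraLR iE; rewrite negb_exists_in => /forall_inP h.
    rewrite -ltnNge -(card_imset E (@perm_inj _ s^-1%g)).
    have : (#|(s^-1)%g @: E| <= #|~: [set j : 'I_n | j < i.+1]|)%N.
      apply/subset_leq_card/subsetP => _ /imsetP[y yE ->].
      by rewrite !inE ltnS h.
    have := cardsC [set j : 'I_n | (j < i.+1)%N].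
    by rewrite card_ord card_ord_ltn //; lia.
  by apply: le_trans (Eth y yE) _; rewrite -[in leLHS](permKV s y) mono.
(* Swapping [r] into position [i] changes the value at each position by at most 4, so the resulting
   order is an 8-approximate sorting. *)
- move=> r rv; apply/existsP; exists (tperm i ((s^-1)%g r) * s)%g.
  rewrite permM tpermL permKV eqxx andbT.
  have near p : `|x ((tperm i ((s^-1)%g r) * s)%g p) - x (s p)| <= 4%:R.
    rewrite permM; case: tpermP => [->|->|_ _]; rewrite ?permKV //.
      by rewrite distrC.
    by rewrite subrr normr0.
  apply/forallP => a; apply/forallP => b; apply/implyP => ab.
  rewrite /approx_ge; have := mono _ _ (ltnW ab).
  have := near a; have := near b; rewrite !ler_norml; lra.
Qed.

End OrderStatistics.

(** * Chernoff bounds for random residue classes *)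

Section Concentration.
Variable R : realType.

(** Uniform labels below [M] stay uniform modulo every divisor [k], so one label space serves rounds
    with different numbers of bins. *)
Lemma card_modn_eq (k M j : nat) : (j < k)%N -> (k %| M)%N ->
  (#|[set a : 'I_M | a %% k == j]| * k)%N = M.
Proof.
move=> jk /dvdnP[c ->]; congr (_ * _)%N.
rewrite -sum1dep_card -(big_mkord (fun a => a %% k == j)%N (fun=> 1%N)).
elim: c => [|c IH]; first by rewrite big_geq.
rewrite mulSn addnC (@big_cat_nat _ _ _ (c * k)) ?leq_addr //= IH.
rewrite -{1}[(c * k)%N]add0n addnC big_addn addKn.
under eq_bigl do rewrite addnC modnMDl.
rewrite big_mkord (eq_bigl (fun a => a == Ordinal jk)) ?big_pred1_eq ?addn1 //.
by move=> a; rewrite modn_small.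
Qed.

(** From [exp (- t) >= 1 - t] and [(1 + t + 2 t^2) (1 - t) = 1 + t^2 (1 - 2 t)]. Negative [t] are
    covered too, for the lower tail. *)
Lemma expR_quad (t : R) : t <= 2%:R^-1 -> expR t <= 1 + t + 2%:R * t ^+ 2.
Proof.
move=> t2; have h := expR_ge1Dx (- t).
have p0 : 0 < 1 - t by lra.
have := expRxMexpNx_1 t => e1.
have ge0 := expR_ge0 t.
have : expR t * (1 - t) <= 1 by rewrite -[leRHS]e1 ler_wpM2l.
suff : 1 <= (1 + t + 2%:R * t ^+ 2) * (1 - t).
  by move=> a b; rewrite -(ler_pM2r p0); apply: le_trans b a.
nra.
Qed.

Variables (n M : nat) (k j : nat).
Hypotheses (jk : (j < k)%N) (kM : (k %| M)%N).

Definition class_card (X : {set 'I_n}) (l : {ffun 'I_n -> 'I_M}) : nat :=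
  #|[set y in X | (l y %% k == j)%N]|.

(** The labels are independent, so the exponential moment factors over the items; each factor is
    bounded by [1 + u <= exp u]. *)
Lemma class_card_mgf (X : {set 'I_n}) (t : R) :
  \sum_(l : {ffun 'I_n -> 'I_M}) expR (t * (class_card X l)%:R) <=
  (M ^ n)%:R * expR (#|X|%:R * ((expR t - 1) / k%:R)).
Proof.
have k0 : (0 : R) < k%:R by rewrite ltr0n; apply: leq_ltn_trans jk.
pose F (y : 'I_n) (a : 'I_M) : R :=
  if (y \in X) && (a %% k == j)%N then expR t else 1.
rewrite (eq_bigr (fun l : {ffun 'I_n -> 'I_M} => \prod_y F y (l y))); last first.
  move=> l _; rewrite -big_mkcond /=.
  rewrite expRM_natr /class_card -prodr_const.
  by apply: eq_bigl => y; rewrite !inE.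
rewrite -bigA_distr_bigA /=.
have -> : (M ^ n)%:R * expR (#|X|%:R * ((expR t - 1) / k%:R)) =
    \prod_(y : 'I_n) (M%:R * (if y \in X then expR ((expR t - 1) / k%:R) else 1)) :> R.
  rewrite big_split /= prodr_const card_ord natrX; congr (_ * _).
  by rewrite -big_mkcond /= prodr_const mulrC expRM_natr.
apply: ler_prod => y _; apply/andP; split.
  by apply: sumr_ge0 => a _; rewrite /F; case: ifP; rewrite ?expR_ge0.
rewrite /F; case: (y \in X) => /=; last first.
  by rewrite sumr_const card_ord mulr1.
have -> : \sum_(a < M) (if (a %% k == j)%N then expR t else 1) =
    M%:R * (1 + (expR t - 1) / k%:R).
  rewrite (eq_bigr (fun a : 'I_M => 1 + (if (a %% k == j)%N then expR t - 1 else 0))); last first.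
    by move=> a _; case: ifP; rewrite ?addr0 // addrC subrK.
  rewrite big_split /= sumr_const card_ord -big_mkcond /= sumr_const.
  rewrite -cardsE mulrDr mulr1; congr (_ + _).
  have := card_modn_eq jk kM; move: #|_| => c cM.
  by rewrite -cM natrM -mulrA [k%:R * _]mulrC divfK ?gt_eqF // mulr_natl.
by rewrite ler_wpM2l // expR_ge1Dx.
Qed.

(** Markov's inequality for the exponential moment; either sign of [t] is allowed, which gives both
    tails. *)
Lemma class_card_tail (X : {set 'I_n}) (t a : R) :
  #|[set l : {ffun 'I_n -> 'I_M} | a <= t * (class_card X l)%:R]|%:R <=
  (M ^ n)%:R * expR (#|X|%:R * ((expR t - 1) / k%:R) - a).
Proof.
rewrite expRD mulrA expRN ler_pdivlMr ?expR_gt0 //.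
apply: le_trans (class_card_mgf X t).
rewrite -sum1_card natr_sum big_distrl /= [leRHS](bigID (fun l => a <= t * (class_card X l)%:R)) /=.
apply: ler_wpDr; first by apply: sumr_ge0 => l _; apply: expR_ge0.
rewrite (eq_bigl (fun l => a <= t * (class_card X l)%:R)); last by move=> l; rewrite inE.
by apply: ler_sum => l al; rewrite mul1r ler_expR.
Qed.

Definition balanced (H : nat) (X : {set 'I_n}) (l : {ffun 'I_n -> 'I_M}) : bool :=
  ((k * class_card X l <= #|X| + k * H) && (#|X| <= k * class_card X l + k * H))%N.

Lemma unbalanced_card (H D : nat) (X : {set 'I_n}) :
  (0 < D)%N -> (H <= D)%N -> (#|X| <= 2 * D * k)%N ->
  #|[set l | ~~ balanced H X l]|%:R <=
  2%:R * (M ^ n)%:R * expR (- (H%:R ^+ 2 / (16%:R * D%:R))) :> R.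
Proof.
move=> D0 HD XD.
have k0 : (0 : R) < k%:R by rewrite ltr0n; apply: leq_ltn_trans jk.
have D0R : (0 : R) < D%:R by rewrite ltr0n.
have HDR : H%:R <= D%:R :> R by rewrite ler_nat.
have H0R : (0 : R) <= H%:R by [].
(* This [t] minimises [4 D t^2 - t H], the exponent that the quadratic bound gives for a mean of at
   most [2 D]; [H <= D] keeps it below 1/2. *)
pose t : R := H%:R / (8%:R * D%:R).
pose mu : R := #|X|%:R / k%:R.
have mu0 : 0 <= mu by rewrite divr_ge0.
have muD : mu <= 2%:R * D%:R.
  by rewrite ler_pdivrMr // -!natrM ler_nat.
have t0 : 0 <= t by rewrite divr_ge0 // mulr_ge0.
have t2 : t <= 2%:R^-1.
  by rewrite ler_pdivrMr; [lra | rewrite mulr_gt0].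
have tD : t * (8%:R * D%:R) = H%:R by rewrite divfK // gt_eqF // mulr_gt0.
have goal_exp : - (H%:R ^+ 2 / (16%:R * D%:R)) = 4%:R * D%:R * t ^+ 2 - t * H%:R.
  by rewrite /t; field; rewrite gt_eqF.
have bound s : s <= 2%:R^-1 -> s ^+ 2 = t ^+ 2 ->
    #|X|%:R * ((expR s - 1) / k%:R) - (s * mu + t * H%:R) <=
    - (H%:R ^+ 2 / (16%:R * D%:R)).
  move=> s2 st; rewrite goal_exp.
  have -> : #|X|%:R * ((expR s - 1) / k%:R) = mu * (expR s - 1).
    by rewrite /mu mulrCA mulrC.
  have := expR_quad s2; rewrite st => es.
  have : mu * (expR s - 1) <= mu * (s + 2%:R * t ^+ 2).
    by apply: ler_wpM2l => //; lra.
  have : mu * t ^+ 2 <= 2%:R * D%:R * t ^+ 2 by rewrite ler_wpM2r // sqr_ge0.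
  lra.
pose E (s : R) := [set l : {ffun 'I_n -> 'I_M} |
  s * mu + t * H%:R <= s * (class_card X l)%:R].
have Ele s : s <= 2%:R^-1 -> s ^+ 2 = t ^+ 2 -> #|E s|%:R <=
    (M ^ n)%:R * expR (- (H%:R ^+ 2 / (16%:R * D%:R))) :> R.
  move=> s2 st; apply: le_trans (class_card_tail X s (s * mu + t * H%:R)) _.
  by rewrite ler_wpM2l // ler_expR bound.
have sub : [set l | ~~ balanced H X l] \subset E t :|: E (- t).
  apply/subsetP => l; rewrite !inE negb_and -!ltnNge => /orP[h|h];
    apply/orP; [left|right].
    rewrite -mulrDr ler_wpM2l // -lerBrDr ler_pdivrMr // mulrBl lerBrDr.
    by rewrite -!natrM -natrD ler_nat; move: h; lia.
  rewrite !mulNr lerNr opprD opprK -mulrBr ler_wpM2l // lerBrDr ler_pdivlMr //.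
  by rewrite mulrDl -!natrM -natrD ler_nat; move: h; lia.
apply: (@le_trans _ _ (#|E t|%:R + #|E (- t)|%:R)).
  rewrite -natrD ler_nat; apply: leq_trans (subset_leq_card sub) _.
  exact: leq_card_setU.
have t2' : - t <= 2%:R^-1 by lra.
have := Ele _ t2 erefl; have := Ele _ t2' (sqrrN _).
lra.
Qed.

End Concentration.

(** * Replacing one coordinate of a random function *)

Section Resampling.
Variables (I V : finType).

Definition resample (w : {ffun I -> V}) (t : I) (l : V) : {ffun I -> V} :=
  [ffun s => if s == t then l else w s].

Lemma resample_same w t l : resample w t l t = l.
Proof. by rewrite ffunE eqxx. Qed.

Lemma resample_other w t l s : s != t -> resample w t l s = w s.
Proof. by rewrite ffunE => /negPf->. Qed.

(* Exchanging the coordinate [w t] with an independent copy of it is an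
   involution, so the fresh copy may replace [w t] wherever the rest does
   not depend on [w t]. *)
Lemma resample_card (R : realType) (t : I) (E : {ffun I -> V} -> pred V) (b : R) :
  (forall w l, E (resample w t l) =1 E w) ->
  (forall w, #|[set l | E w l]|%:R <= b * #|V|%:R) ->
  #|[set w : {ffun I -> V} | E w (w t)]|%:R <= b * #|{ffun I -> V}|%:R.
Proof.
move=> Eres Eb; case: (posnP #|V|) => [V0|V0].
  have e0 : #|{ffun I -> V}| = 0%N.
    by rewrite card_ffun V0 exp0n //; apply/card_gt0P; exists t.
  rewrite e0 mulr0; have := max_card [set w : {ffun I -> V} | E w (w t)].
  by rewrite e0 leqn0 => /eqP->.
have V0R : (0 : R) < #|V|%:R by rewrite ltr0n.
rewrite -(ler_pM2r V0R).
pose swap (p : {ffun I -> V} * V) := (resample p.1 t p.2, p.1 t).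
have swapK : involutive swap.
  move=> [w l]; rewrite /swap /= resample_same; congr (_, _).
  by apply/ffunP => s; rewrite !ffunE; case: eqP => [->|].
have -> : #|[set w : {ffun I -> V} | E w (w t)]|%:R * #|V|%:R =
    \sum_(p : {ffun I -> V} * V) (E p.1 (p.1 t))%:R :> R.
  rewrite -(pair_bigA _ (fun w (l : V) => (E w (w t))%:R)) /=.
  rewrite -sum1dep_card natr_sum big_distrl /= big_mkcond /=.
  apply: eq_bigr => w _; rewrite sumr_const.
  by case: (E w _); rewrite ?mul1r ?mul0rn.
rewrite (reindex_inj (inv_inj swapK)) /=.
under eq_bigr do rewrite resample_same Eres.
rewrite -(pair_bigA _ (fun w (l : V) => (E w l)%:R)) /=.
apply: (@le_trans _ _ (\sum_(w : {ffun I -> V}) b * #|V|%:R)).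
  apply: ler_sum => w _; apply: le_trans (Eb w).
  by rewrite -sum1dep_card natr_sum [leRHS]big_mkcond /=; apply: ler_sum => l _; case: (E w l).
by rewrite sumr_const -[leLHS]mulr_natr mulrAC.
Qed.

End Resampling.

(** * One round: classifying the undecided items *)

Section Classification.
Variables (n : nat) (i : 'I_n).

(* [active] items are still undecided, [low] items are placed below the
   target; the remaining ones are placed above it. [won] collects the pairs
   (winner, loser) of all answers so far. *)
Record state := State {
  active : {set 'I_n};
  low : {set 'I_n};
  lo_pivots : {set 'I_n};
  hi_pivots : {set 'I_n};
  won : {set 'I_n * 'I_n} }.

Definition init_state : state := State setT set0 set0 set0 set0.

Definition high (st : state) : {set 'I_n} := ~: (active st :|: low st).

(** Pairs are submitted in increasing order only, so the adversary cannot answer the two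
    orientations inconsistently. *)
Definition canon (a b : 'I_n) : comparison n := if (a < b)%N then (a, b) else (b, a).

Definition beat (r : round_answers n) : rel 'I_n :=
  fun a b => (a != b) && (r (canon a b) == Some a).

Section Step.
Variables (lab : 'I_n -> nat) (S : {set 'I_n}).

Definition bin (j : nat) : {set 'I_n} := [set y in S | lab y == j].

Definition step_queries : {set comparison n} :=
  [set p : 'I_n * 'I_n | (p.1 < p.2)%N &&
    [|| p.1 \in bin 0, p.2 \in bin 0
      | [&& p.1 \in S, p.2 \in S & lab p.1 == lab p.2]]].

Variables (e : nat) (B : rel 'I_n).

Definition is_lo (p : 'I_n) : bool := (#|[set y | B p y]| <= i)%N.

Definition new_lo : {set 'I_n} := [set p in bin 0 | is_lo p].
Definition new_hi : {set 'I_n} := [set p in bin 0 | ~~ is_lo p].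

(** Pivots are decided by [is_lo] alone, so bin 0 always leaves the undecided set. *)
Definition drop_low : {set 'I_n} :=
  [set y in S | if y \in bin 0 then is_lo y
     else (#|[set z in bin (lab y) | B y z]| + e < #|new_lo|)%N].

Definition drop_high : {set 'I_n} :=
  [set y in S | if y \in bin 0 then ~~ is_lo y
     else (#|[set z in bin (lab y) | B z y]| + e < #|new_hi|)%N].

End Step.

Definition step (lab : 'I_n -> nat) (e : nat) (B : rel 'I_n) (st : state) : state :=
  let S := active st in
  State (S :\: (drop_low lab S e B :|: drop_high lab S e B))
        (low st :|: drop_low lab S e B)
        (lo_pivots st :|: new_lo lab S B)
        (hi_pivots st :|: new_hi lab S B)
        (won st :|: [set p : 'I_n * 'I_n | B p.1 p.2]).

Section Analysis.
Variables (R : realType) (x : 'I_n -> R).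

Definition downset (th : 'I_n) : {set 'I_n} := [set y | x y <= x th].
Definition upset (th : 'I_n) : {set 'I_n} := [set y | x th <= x y].

Section StepAnalysis.
Variables (lab : 'I_n -> nat) (k e : nat) (B : rel 'I_n) (st : state).
Let S := active st.
Let st' := step lab e B st.

(** Bins are compared with each other rather than with the mean, because the arguments transfer
    counts between bin 0 and another bin. *)
Definition evenly (X : {set 'I_n}) : Prop :=
  forall j j', (j < k)%N -> (j' < k)%N ->
    (#|X :&: bin lab S j| <= #|X :&: bin lab S j'| + e)%N.

Hypotheses (lab_lt : forall y, (lab y < k)%N)
  (even_down : forall th, evenly (downset th))
  (even_up : forall th, evenly (upset th))
  (Bsound : forall a b, B a b -> x b - 1 <= x a)
  (Basym : forall a b, B a b -> ~~ B b a)
  (Btotal : {in S &, forall a b, a != b -> lab a = lab b -> B a b || B b a}).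

Let k_gt0 : (0 < k)%N.
Proof. exact: leq_ltn_trans (lab_lt i). Qed.

(** All new lo pivots lie in the downset of the largest lo pivot [th]. An item above [x th + 1]
    beats that whole downset in its own bin, which by evenness is too many victories to be
    dropped. *)
Lemma drop_low_safe y : y \in drop_low lab S e B ->
  exists2 p, p \in lo_pivots st' & x y <= x p + 1.
Proof.
rewrite inE => /andP[yS]; case: ifP => [yP ylo|yNP ylt].
  by exists y; [rewrite !inE ylo yS; move: yP; rewrite inE yS /= => ->; rewrite orbT | lra].
have /set0Pn[p0 p0lo] : lo_pivots st' != set0.
  apply: contraTneq ylt => lo0; have : new_lo lab S B = set0.
    by apply/eqP; rewrite -subset0 -lo0 subsetUr.
  by move=> ->; rewrite cards0.
have [th thlo thmax] := @arg_maxP _ _ _ p0 (mem (lo_pivots st')) x p0lo.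
exists th => //; rewrite leNgt; apply/negP => yth.
move: ylt; rewrite ltnNge => /negP; apply.
apply: (@leq_trans #|downset th :&: bin lab S 0|).
  apply/subset_leq_card/subsetP => p; rewrite !inE => /andP[pP plo].
  have ppiv : p \in lo_pivots st' by rewrite !inE pP plo orbT.
  by rewrite pP andbT; apply: thmax.
apply: leq_trans (even_down th k_gt0 (lab_lt y)) _; rewrite leq_add2r.
apply/subset_leq_card/subsetP => z; rewrite !inE => /and3P[zth zS /eqP zy].
rewrite zS zy eqxx /=; have zy' : y != z by apply: contraTneq yth => ->; lra.
have /orP[//|/Bsound] := Btotal yS zS zy' (esym zy); lra.
Qed.

Lemma drop_high_safe y : y \in drop_high lab S e B ->
  exists2 p, p \in hi_pivots st' & x p - 1 <= x y.
Proof.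
rewrite inE => /andP[yS]; case: ifP => [yP ylo|yNP ylt].
  by exists y; [rewrite !inE ylo yS; move: yP; rewrite inE yS /= => ->; rewrite orbT | lra].
have /set0Pn[p0 p0lo] : hi_pivots st' != set0.
  apply: contraTneq ylt => lo0; have : new_hi lab S B = set0.
    by apply/eqP; rewrite -subset0 -lo0 subsetUr.
  by move=> ->; rewrite cards0.
have [th thlo thmin] := @arg_minP _ _ _ p0 (mem (hi_pivots st')) x p0lo.
exists th => //; rewrite leNgt; apply/negP => yth.
move: ylt; rewrite ltnNge => /negP; apply.
apply: (@leq_trans #|upset th :&: bin lab S 0|).
  apply/subset_leq_card/subsetP => p; rewrite !inE => /andP[pP plo].
  have ppiv : p \in hi_pivots st' by rewrite !inE pP plo orbT.
  by rewrite pP andbT; apply: thmin.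
apply: leq_trans (even_up th k_gt0 (lab_lt y)) _; rewrite leq_add2r.
apply/subset_leq_card/subsetP => z; rewrite !inE => /and3P[zth zS /eqP zy].
rewrite zS zy eqxx /=; have zy' : z != y by apply: contraTneq yth => <-; lra.
have /orP[//|/Bsound] := Btotal zS yS zy' zy; lra.
Qed.

(** As lo pivots are at most [v + 1] and hi pivots at least [v - 1], both members of such a pair are
    within 2 of [v]. *)
Definition squeezed (st : state) : bool :=
  [exists p in lo_pivots st, exists p' in hi_pivots st, x p' <= x p + 1].

(** The existential form makes [Z] empty when there is no lo pivot; otherwise [Z] is the downset of
    the largest one. Likewise for [W]. *)
Let Z : {set 'I_n} := [set y | [exists p in lo_pivots st', x y <= x p]].
Let W : {set 'I_n} := [set y | [exists p in hi_pivots st', x p <= x y]].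

Let evenly_Z : evenly Z.
Proof.
have [/set0Pn[p0 p0lo]|/negPn/eqP lo0] := boolP (lo_pivots st' != set0); last first.
  have -> : Z = set0.
    by apply/setP => y; rewrite !inE; apply/exists_inP => -[p]; rewrite lo0 inE.
  by move=> j j' _ _; rewrite !set0I cards0.
have [th thlo thmax] := @arg_maxP _ _ _ p0 (mem (lo_pivots st')) x p0lo.
suff -> : Z = downset th by exact: even_down.
apply/setP => y; rewrite !inE; apply/exists_inP/idP => [[p /thmax]|yth].
  by move=> pth yp; apply: le_trans yp pth.
by exists th.
Qed.

Let evenly_W : evenly W.
Proof.
have [/set0Pn[p0 p0lo]|/negPn/eqP lo0] := boolP (hi_pivots st' != set0); last first.
  have -> : W = set0.
    by apply/setP => y; rewrite !inE; apply/exists_inP => -[p]; rewrite lo0 inE.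
  by move=> j j' _ _; rewrite !set0I cards0.
have [th thlo thmin] := @arg_minP _ _ _ p0 (mem (hi_pivots st')) x p0lo.
suff -> : W = upset th by exact: even_up.
apply/setP => y; rewrite !inE; apply/exists_inP/idP => [[p /thmin]|yth].
  by move=> pth yp; apply: le_trans pth yp.
by exists th.
Qed.

Let evenly_T : evenly setT.
Proof.
have [th _ thmax] := @arg_maxP _ _ _ i predT x isT.
suff -> : setT = downset th by exact: even_down.
by apply/setP => y; rewrite !inE; apply/esym/thmax.
Qed.

Hypothesis not_squeezed : ~~ squeezed st'.

Let gap z w : z \in Z -> w \in W -> x z + 1 < x w.
Proof.
rewrite !inE => /exists_inP[p pl zp] /exists_inP[p' ph pw].
move: not_squeezed; rewrite negb_exists_in => /forall_inP/(_ p pl).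
rewrite negb_exists_in => /forall_inP/(_ p' ph); rewrite -ltNge; lra.
Qed.

(** A new hi pivot inside [Z] would lie in both [Z] and [W], against the gap. *)
Let pivots_Z : Z :&: bin lab S 0 = new_lo lab S B.
Proof.
apply/setP => p; rewrite in_setI [RHS]inE andbC.
case pP : (p \in bin lab S 0) => //=; apply/idP/idP => [pZ|plo].
  apply: contraT => phi; have pW : p \in W.
    rewrite inE; apply/exists_inP; exists p; rewrite // !inE phi orbC.
    by move: pP; rewrite inE => ->.
  by have := gap pZ pW; lra.
rewrite inE; apply/exists_inP; exists p; rewrite // !inE plo orbC.
by move: pP; rewrite inE => ->.
Qed.

Let pivots_W : W :&: bin lab S 0 = new_hi lab S B.
Proof.
apply/setP => p; rewrite in_setI [RHS]inE andbC.
case pP : (p \in bin lab S 0) => //=; apply/idP/idP => [pW|plo].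
  apply/negP => phi; have pZ : p \in Z.
    rewrite inE; apply/exists_inP; exists p; rewrite // !inE phi orbC.
    by move: pP; rewrite inE => ->.
  by have := gap pZ pW; lra.
rewrite inE; apply/exists_inP; exists p; rewrite // !inE plo orbC.
by move: pP; rewrite inE => ->.
Qed.

(** The bin splits into its parts in [Z], in [W] and in the middle [M], which contain at most
    [10 e], [10 e] and [3 e] survivors. *)
Let survivors_group j : (j < k)%N ->
  (#|bin lab (active st') j| <= 23 * e)%N.
Proof.
move=> jk; have [->|j0] := posnP j.
  suff -> : bin lab (active st') 0 = set0 by rewrite cards0.
  apply/setP => y; rewrite !inE; case: (y \in S); rewrite ?andbF //= andbT.
  by case: (lab y == 0)%N; rewrite ?andbF //= andbT; case: (is_lo B y).
set q := #|new_lo lab S B|; set h := #|new_hi lab S B|.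
pose G := bin lab S j; pose M := G :\: (Z :|: W).
have Zj0 := evenly_Z jk k_gt0; have Z0j := evenly_Z k_gt0 jk.
have Wj0 := evenly_W jk k_gt0; have W0j := evenly_W k_gt0 jk.
have Tj0 := evenly_T jk k_gt0.
rewrite pivots_Z -/q -/G in Zj0 Z0j; rewrite pivots_W -/h -/G in Wj0 W0j.
rewrite !setTI -/G in Tj0.
have dZW : Z :&: W = set0.
  apply/setP => y; rewrite in_setI in_set0; apply/negP => /andP[yZ yW].
  by have := gap yZ yW; lra.
have cP : #|bin lab S 0| = (q + h)%N.
  rewrite /q /h -(cardsID [set p | is_lo B p] (bin lab S 0)).
  by congr (_ + _)%N; apply: eq_card => p; rewrite !inE // andbC.
have cG : (#|M| + #|Z :&: G| + #|W :&: G|)%N = #|G|.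
  rewrite -[RHS](cardsID (Z :|: W) G) -/M setIUr cardsU ![G :&: _]setIC.
  by rewrite setIACA dZW set0I cards0 subn0; lia.
(* Evenness costs [e] three times: for the whole bin, for [Z] and for [W]. *)
have cM : (#|M| <= 3 * e)%N by lia.
pose X := bin lab (active st') j.
have XG : X \subset G.
  by apply/subsetP => y; rewrite !inE => /andP[/andP[_ ->]].
have Xout y : y \in X -> (q <= #|[set z in G | B y z]| + e)%N /\
                         (h <= #|[set z in G | B z y]| + e)%N.
  rewrite !inE => /andP[/andP[nd yS] /eqP yj].
  by move: nd; rewrite yS yj eqn0Ngt j0 /= negb_or -!leqNgt => /andP[].
(* Members of [Z] never beat members of [W], so a survivor's wins outside [Z] lie in [M]; this costs
   [3 e] besides the threshold [e]. With [#|Z :&: G| <= q + e] the score bound gives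
   [2 (e + 4 e)]. *)
have cZ : (#|X :&: Z| <= 10 * e)%N.
  have [] := @high_score_card 'I_n B (Z :&: G) (X :&: Z) q (4 * e) Basym.
  - by rewrite setIC setIS.
  - move=> y /setIP[yX yZ]; have [le1 _] := Xout y yX.
    apply: leq_trans le1 _.
    apply: (@leq_trans (#|[set z in Z :&: G | B y z]| + #|M| + e)); last first.
      by rewrite -addnA leq_add2l; lia.
    rewrite leq_add2r.
    apply: leq_trans (leq_card_setU _ _).
    apply/subset_leq_card/subsetP => z; rewrite in_set => /andP[zG Byz].
    rewrite in_setU in_set in_setI zG Byz !andbT in_setD zG andbT in_setU negb_or.
    case: (z \in Z) => //=; apply/negP => zW.
    by have := gap yZ zW; have := Bsound Byz; lra.
  - lia.
  - lia.
have cW : (#|X :&: W| <= 10 * e)%N.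
  have [] := @high_score_card 'I_n (fun a b => B b a) (W :&: G) (X :&: W) h (4 * e).
  - by move=> a b; apply: Basym.
  - by rewrite setIC setIS.
  - move=> y /setIP[yX yW]; have [_ le1] := Xout y yX.
    apply: leq_trans le1 _.
    apply: (@leq_trans (#|[set z in W :&: G | B z y]| + #|M| + e)); last first.
      by rewrite -addnA leq_add2l; lia.
    rewrite leq_add2r.
    apply: leq_trans (leq_card_setU _ _).
    apply/subset_leq_card/subsetP => z; rewrite in_set => /andP[zG Bzy].
    rewrite in_setU in_set in_setI zG Bzy !andbT in_setD zG andbT in_setU negb_or.
    case: (z \in W); rewrite //= andbT; apply/negP => zZ.
    by have := gap zZ yW; have := Bsound Bzy; lra.
  - lia.
  - lia.
have : (#|X| <= #|X :&: Z| + #|X :&: W| + #|M|)%N.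
  apply: leq_trans (leq_trans (leq_card_setU _ _) (leq_add (leq_card_setU _ _) (leqnn _))).
  apply/subset_leq_card/subsetP => y yX.
  rewrite !(in_setU, in_setI) yX in_setD (subsetP XG) // in_setU andbT.
  by case: (y \in Z) => //; case: (y \in W).
rewrite -/X; lia.
Qed.

Lemma survivors_card : (#|active st'| <= 23 * e * k)%N.
Proof.
have -> : #|active st'| = (\sum_(j < k) #|bin lab (active st') j|)%N.
  rewrite -sum1_card (partition_big (fun y => Ordinal (lab_lt y)) predT) //=.
  apply: eq_bigr => j _; rewrite -sum1_card; apply: eq_bigl => y.
  by rewrite [RHS]in_set -val_eqE.
apply: (@leq_trans (\sum_(j < k) 23 * e)).
  by apply: leq_sum => j _; apply: survivors_group.
by rewrite big_const_ord iter_addn addn0 mulnC.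
Qed.

End StepAnalysis.
End Analysis.
End Classification.

(** * What the answers reveal about the values *)

Section Beat.
Variables (R : realType) (n : nat).

Lemma canonC (a b : 'I_n) : a != b -> canon b a = canon a b.
Proof.
move=> ab; rewrite /canon; case: ltngtP => // /val_inj ab'.
by rewrite ab' eqxx in ab.
Qed.

Lemma beat_asym (r : round_answers n) a b : beat r a b -> ~~ beat r b a.
Proof.
rewrite /beat => /andP[ab /eqP rab]; rewrite negb_and; apply/orP; right.
by rewrite (canonC ab) rab; apply: contra ab => /eqP[->].
Qed.

Variables (x : 'I_n -> R) (adv : adversary n) (h : history n).
Variable Q : {set comparison n}.

Lemma comparatorP (bit : bool) (p : comparison n) :
  (comparator x bit p = p.1 /\ x p.2 - 1 <= x p.1) \/
  (comparator x bit p = p.2 /\ x p.1 - 1 <= x p.2).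
Proof.
rewrite /comparator; case: ifP => [far|/negbT].
  by case: ifP => [lt12|/negbT]; [right|rewrite -leNgt => le21; left]; split=> //; lra.
rewrite -leNgt ler_norml => /andP[lo hi].
by case: bit; [left|right]; split=> //; lra.
Qed.

Lemma beat_sound a b : beat (answer x adv h Q) a b -> x b - 1 <= x a.
Proof.
move=> /andP[ab]; rewrite ffunE; case: ifP => // _ /eqP[].
have [[-> le]|[-> le]] := comparatorP (adv h Q (canon a b)) (canon a b);
  move: le; rewrite /canon; case: ifP => _ /= le eqa //;
  by rewrite eqa eqxx in ab.
Qed.

Lemma beat_total a b : a != b -> canon a b \in Q ->
  beat (answer x adv h Q) a b || beat (answer x adv h Q) b a.
Proof.
move=> ab abQ; rewrite /beat ab [b == a]eq_sym ab /=.
rewrite (canonC ab) ffunE abQ.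
have [[-> _]|[-> _]] := comparatorP (adv h Q (canon a b)) (canon a b);
  by rewrite /canon; case: ifP => _ /=; rewrite eqxx ?orbT.
Qed.

End Beat.

(** * Coverage and number of the comparisons in a round *)

Section Queries.
Variables (n : nat) (lab : 'I_n -> nat) (S : {set 'I_n}).

Lemma canon_queries_pivot p y : p != y -> p \in bin lab S 0 ->
  canon p y \in step_queries lab S.
Proof.
move=> py pP; rewrite inE /canon; case: (ltngtP p y) => [lt|lt|/val_inj e] /=.
- by rewrite lt pP.
- by rewrite lt pP orbT.
- by rewrite e eqxx in py.
Qed.

Lemma canon_queries_group a b : a != b -> a \in S -> b \in S -> lab a = lab b ->
  canon a b \in step_queries lab S.
Proof.
move=> ab aS bS lab_ab; rewrite inE /canon; case: (ltngtP a b) => [lt|lt|/val_inj e] /=.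
- by rewrite lt aS bS lab_ab eqxx !orbT.
- by rewrite lt aS bS lab_ab eqxx !orbT.
- by rewrite e eqxx in ab.
Qed.

(** At most [G * n] pairs each have a pivot first, have a pivot second, or lie in one bin. *)
Lemma card_step_queries (G : nat) : (forall y, #|bin lab S (lab y)| <= G)%N ->
  (#|bin lab S 0| <= G)%N -> (#|step_queries lab S| <= 3 * G * n)%N.
Proof.
move=> Gle G0le.
pose Q3 := [set p : 'I_n * 'I_n | p.2 \in bin lab S (lab p.1)].
have sub : step_queries lab S \subset
    (setX (bin lab S 0) setT :|: setX setT (bin lab S 0)) :|: Q3.
  apply/subsetP => -[a b]; rewrite in_set => /andP[_ /= /or3P[aP|bP|/and3P[aS bS /eqP ab]]].
  - by rewrite !(in_setU, in_setX) aP in_setT.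
  - by rewrite !(in_setU, in_setX) bP !in_setT /= orbT.
  - by rewrite in_setU; apply/orP; right; rewrite !inE /= bS ab eqxx.
have c3 : (#|Q3| <= n * G)%N.
  rewrite -sum1_card (partition_big (fun p => p.1) predT) //=.
  apply: (@leq_trans (\sum_(a < n) G)); last by rewrite big_const_ord iter_addn addn0 mulnC.
  apply: leq_sum => a _; rewrite sum1dep_card; apply: leq_trans (Gle a).
  rewrite -(card_imset (bin lab S (lab a)) (f := fun b => (a, b))); last first.
    by move=> b c [].
  apply/subset_leq_card/subsetP => -[a' b]; rewrite !inE /= => /andP[/andP[bS bl] /eqP aa].
  by apply/imsetP; exists b; rewrite ?inE ?bS ?aa // -aa.
apply: leq_trans (subset_leq_card sub) _; apply: leq_trans (leq_card_setU _ _) _.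
have -> : (3 * G * n = G * n + n * G + n * G)%N by lia.
apply: leq_add => //; apply: leq_trans (leq_card_setU _ _) _.
by rewrite !cardsX cardsT card_ord leq_add // leq_mul.
Qed.

End Queries.

(** * Final choice and invariants *)

Section Selection.
Variables (n : nat) (i : 'I_n).

Definition kings (B : rel 'I_n) (P : {set 'I_n}) : pred 'I_n :=
  fun a => (a \in P) &&
    [forall b in P, [|| a == b, B a b | [exists c, B a c && B c b]]].

(** The relation is reversed for hi pivots, so that a king there is close to the smallest one
    instead of the largest. *)
Definition select (st : state n) : 'I_n :=
  if (i < #|low st|)%N then
    odflt i [pick a | kings (fun a b => (a, b) \in won st) (lo_pivots st) a]
  else odflt i [pick a | kings (fun a b => (b, a) \in won st) (hi_pivots st) a].

Lemma pick_king (B : rel 'I_n) (P : {set 'I_n}) :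
  {in P &, forall a b, a != b -> B a b || B b a} -> P != set0 ->
  let a := odflt i [pick a | kings B P a] in
  a \in P /\ {in P, forall b, [\/ a = b, B a b | exists2 c, B a c & B c b]}.
Proof.
move=> tot P0 /=; case: pickP => [a /andP[aP /forall_inP ka]|nok] /=.
  split=> // b /ka/or3P[/eqP|Bab|/existsP[c /andP[]]].
  - by constructor 1.
  - by constructor 2.
  - by constructor 3; exists c.
have [a aP ka] := king_exists tot P0.
by have := nok a; rewrite /kings aP; have -> : [forall b in P,
  [|| a == b, B a b | [exists c, B a c && B c b]]] by apply/forall_inP.
Qed.

Variables (R : realType) (x : 'I_n -> R) (v : R).
Hypotheses
  (rank_le : forall (E : {set 'I_n}) (th : R), (i < #|E|)%N ->
     {in E, forall y, x y <= th} -> v <= th)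
  (rank_ge : forall (E : {set 'I_n}) (th : R), (n <= #|E| + i)%N ->
     {in E, forall y, th <= x y} -> th <= v).

(** Kept apart from [safe]: validity survives any partition into bins, whereas safety is propagated
    using evenness. *)
Record valid (st : state n) : Prop := Valid {
  lo_le : {in lo_pivots st, forall p, x p <= v + 1};
  hi_ge : {in hi_pivots st, forall p, v <= x p + 1};
  won_total : forall p y, p \in lo_pivots st :|: hi_pivots st -> p != y ->
    ((p, y) \in won st) || ((y, p) \in won st);
  won_sound : forall a b, (a, b) \in won st -> x b - 1 <= x a }.

Record safe (st : state n) : Prop := Safe {
  low_le : {in low st, forall y, exists2 p, p \in lo_pivots st & x y <= x p + 1};
  high_ge : {in high st, forall y, exists2 p, p \in hi_pivots st & x p - 1 <= x y} }.

(** A king loses at most 2 against the extreme pivot. A squeezed pair adds another 2; in the other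
    case the dropped items add only 1. *)
Lemma select_near (st : state n) : valid st ->
  squeezed x st \/ (safe st /\ active st = set0) ->
  `|x (select st) - v| <= 4%:R.
Proof.
move=> [lole hige wtot wsound] fin; rewrite ler_norml /select.
have totlo : {in lo_pivots st &, forall a b, a != b ->
    ((a, b) \in won st) || ((b, a) \in won st)}.
  by move=> a b aP _; apply: wtot; rewrite inE aP.
have tothi : {in hi_pivots st &, forall a b, a != b ->
    ((b, a) \in won st) || ((a, b) \in won st)}.
  by move=> a b aP _ ab; rewrite orbC; apply: wtot => //; rewrite inE aP orbT.
case: ifP => [ilow|/negbT ilow].
  have lo0 : lo_pivots st != set0.
    case: fin => [/exists_inP[p pl _]|[[sl _] _]]; first by apply/set0Pn; exists p.
    have /card_gt0P[y /sl[p pl _]] : (0 < #|low st|)%N by apply: leq_ltn_trans ilow.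
    by apply/set0Pn; exists p.
  have [] := pick_king totlo lo0; set a := odflt _ _ => aP ka.
  have near b : b \in lo_pivots st -> x b - 2%:R <= x a.
    move=> /ka[->|/wsound|[c /wsound + /wsound]]; lra.
  have ale := lole _ aP.
  case: fin => [/exists_inP[p pl /exists_inP[p' ph pp]]|[[sl _] _]].
    have := near _ pl; have := hige _ ph; lra.
  have : v <= x a + 3%:R.
    apply: (rank_le ilow) => y /sl[p pl yp]; have := near _ pl; lra.
  lra.
have hi0 : hi_pivots st != set0.
  case: fin => [/exists_inP[p _ /exists_inP[p' ph _]]|[[_ sh] act0]].
    by apply/set0Pn; exists p'.
  have /card_gt0P[y /sh[p pl _]] : (0 < #|high st|)%N.
    have := cardsC (low st); rewrite /high act0 set0U card_ord.
    by have := ltn_ord i; lia.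
  by apply/set0Pn; exists p.
have [] := pick_king tothi hi0; set a := odflt _ _ => aP ka.
have near b : b \in hi_pivots st -> x a <= x b + 2%:R.
  move=> /ka[->|/wsound|[c /wsound + /wsound]]; lra.
have ale := hige _ aP.
case: fin => [/exists_inP[p pl /exists_inP[p' ph pp]]|[[_ sh] act0]].
  have := near _ ph; have := lole _ pl; lra.
have : x a - 3%:R <= v.
  apply: (@rank_ge (high st)) => [|y /sh[p pl yp]].
    have := cardsC (low st); rewrite /high act0 set0U card_ord; lia.
  have := near _ pl; lra.
lra.
Qed.

Section StepInvariants.
Variables (lab : 'I_n -> nat) (e : nat) (B : rel 'I_n) (st : state n).
Hypotheses (Bsound : forall a b, B a b -> x b - 1 <= x a)
  (Bpivot : forall p y, p \in bin lab (active st) 0 -> p != y -> B p y || B y p).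

(** A pivot meets all items. With at most [i] victories, at least [n - i] items, itself included,
    are at least [x p - 1]; with more, over [i] items are at most [x p + 1]. *)
Lemma step_valid : valid st -> valid (step i lab e B st).
Proof.
move=> [lole hige wtot wsound]; split.
- move=> p /setUP[/lole//|]; rewrite inE => /andP[pP plo].
  suff : x p - 1 <= v by lra.
  apply: (@rank_ge (~: [set y | B p y])) => [|y].
    by rewrite -[X in (X <= _)%N]card_ord -(cardsC [set y | B p y]) addnC leq_add2l.
  rewrite !inE => nB; have [<-|py] := eqVneq p y; first lra.
  by have /orP[|/Bsound//] := Bpivot pP py; rewrite (negPf nB).
- move=> p /setUP[/hige//|]; rewrite inE => /andP[pP].
  rewrite /is_lo -ltnNge => plo; apply: (rank_le plo) => y; rewrite inE => /Bsound; lra.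
- move=> p y pp py; rewrite !in_setU ![_ \in [set _ | _]]inE /=.
  have [pold|pnew] := boolP (p \in lo_pivots st :|: hi_pivots st).
    by case/orP: (wtot _ _ pold py) => ->; rewrite ?orbT.
  have pP : p \in bin lab (active st) 0.
    move: pp pnew; rewrite /= !in_setU.
    by case: (p \in lo_pivots st); case: (p \in hi_pivots st) => //= /orP[];
      rewrite in_set => /andP[].
  by case/orP: (Bpivot pP py) => ->; rewrite !orbT.
- by move=> a b /setUP[/wsound//|]; rewrite inE /= => /Bsound.
Qed.

Lemma squeezed_step : squeezed x st -> squeezed x (step i lab e B st).
Proof.
move=> /exists_inP[p pl /exists_inP[p' ph pp]]; apply/exists_inP.
exists p; first by rewrite inE pl.
by apply/exists_inP; exists p'; first by rewrite inE ph.
Qed.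

Variable k : nat.
Hypotheses (lab_lt : forall y, (lab y < k)%N)
  (even_down : forall th, evenly lab k e st (downset x th))
  (even_up : forall th, evenly lab k e st (upset x th))
  (Btotal : {in active st &, forall a b, a != b -> lab a = lab b -> B a b || B b a}).

Lemma step_safe : safe st -> safe (step i lab e B st).
Proof.
move=> [sl sh]; split => y.
  move=> /setUP[/sl[p pl yp]|yd]; first by exists p; rewrite // inE pl.
  exact: (drop_low_safe lab_lt even_down Bsound Btotal yd).
rewrite in_setC in_setU negb_or => /andP[].
rewrite [active _]/= in_setD negb_and negbK => /orP[yd nlow|yS].
  case/setUP: yd => yd; last exact: (drop_high_safe lab_lt even_up Bsound Btotal yd).
  by move: nlow; rewrite inE yd orbT.
rewrite inE negb_or => /andP[nlow _].
have /sh[p ph yp] : y \in high st by rewrite !inE negb_or yS.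
by exists p; rewrite // inE ph.
Qed.

(** With a single bin every undecided item is a pivot. *)
Lemma step_one_group : k = 1%N -> active (step i lab e B st) = set0.
Proof.
move=> k1; apply/setP => y; rewrite !inE.
have -> : (lab y == 0)%N by have := lab_lt y; rewrite k1; case: (lab y).
by case: (y \in active st) => //=; case: (is_lo i B y).
Qed.

End StepInvariants.
End Selection.

(** * Most partitions are balanced on all threshold sets *)

Lemma card_exists_le (I L : finType) (P : I -> pred L) :
  (#|[set l | [exists i, P i l]]| <= \sum_i #|[set l | P i l]|)%N.
Proof.
rewrite -sum1dep_card big_mkcond /=.
under [X in (_ <= X)%N]eq_bigr do rewrite -sum1dep_card big_mkcond /=.
rewrite exchange_big /=; apply: leq_sum => l _; case: ifP => // /existsP[j Pj].
by rewrite (bigD1 j) //= Pj leq_addr.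
Qed.

Section Good.
Variables (R : realType) (n M : nat) (x : 'I_n -> R) (k H : nat).

Definition good (S : {set 'I_n}) (l : {ffun 'I_n -> 'I_M}) : bool :=
  [forall p : 'I_n * 'I_k, balanced k p.2 H (downset x p.1 :&: S) l
                        && balanced k p.2 H (upset x p.1 :&: S) l].

(** Union bound over at most [n ^ 2] pairs of a threshold and a bin; the 4 counts two sets with two
    tails each. *)
Lemma not_good_card (D : nat) (S : {set 'I_n}) :
  (0 < k <= n)%N -> (k %| M)%N -> (0 < M)%N -> (0 < D)%N -> (H <= D)%N ->
  (#|S| <= 2 * D * k)%N ->
  #|[set l | ~~ good S l]|%:R <=
  4%:R * n%:R ^+ 2 * expR (- (H%:R ^+ 2 / (16%:R * D%:R)))
    * #|{ffun 'I_n -> 'I_M}|%:R :> R.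
Proof.
move=> /andP[k0 kn] kM M0 D0 HD SD.
set E := expR _; have E0 : 0 <= E by exact: expR_ge0.
rewrite card_ffun !card_ord.
pose P (p : 'I_n * 'I_k) (l : {ffun 'I_n -> 'I_M}) :=
  ~~ (balanced k p.2 H (downset x p.1 :&: S) l && balanced k p.2 H (upset x p.1 :&: S) l).
have bad X (j : 'I_k) : #|[set l : {ffun 'I_n -> 'I_M} | ~~ balanced k j H (X :&: S) l]|%:R
    <= 2%:R * (M ^ n)%:R * E :> R.
  apply: unbalanced_card => //; apply: leq_trans SD.
  by apply/subset_leq_card/subsetIr.
have Ple p : #|[set l | P p l]|%:R <= 4%:R * (M ^ n)%:R * E :> R.
  apply: (@le_trans _ _ (#|[set l | ~~ balanced k p.2 H (downset x p.1 :&: S) l]|%:R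
      + #|[set l | ~~ balanced k p.2 H (upset x p.1 :&: S) l]|%:R)).
    rewrite -natrD ler_nat; apply: leq_trans (leq_card_setU _ _).
    by apply/subset_leq_card/subsetP => l; rewrite !inE -negb_and.
  have := bad (downset x p.1) p.2; have := bad (upset x p.1) p.2; lra.
have -> : [set l | ~~ good S l] = [set l | [exists p, P p l]].
  by apply/setP => l; rewrite !inE negb_forall.
apply: (@le_trans _ _ (\sum_(p : 'I_n * 'I_k) #|[set l | P p l]|%:R)).
  by rewrite -natr_sum ler_nat card_exists_le.
apply: le_trans (ler_sum _ (fun p _ => Ple p)) _.
rewrite sumr_const card_prod !card_ord -[leLHS]mulr_natr natrM.
have knR : k%:R <= n%:R :> R by rewrite ler_nat.
have n0 : 0 <= n%:R :> R by [].
have : n%:R * k%:R <= n%:R ^+ 2 :> R by rewrite expr2 ler_wpM2l.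
move=> nk; rewrite [leRHS](_ : _ = 4%:R * (M ^ n)%:R * E * n%:R ^+ 2).
  by rewrite ler_wpM2l // !mulr_ge0.
by ring.
Qed.

(** Each of two bins deviates by at most [H] from the mean, hence the error [2 * H]. *)
Lemma good_evenly (st : state n) (l : {ffun 'I_n -> 'I_M}) : (0 < k)%N ->
  good (active st) l ->
  (forall th, evenly (fun y => l y %% k)%N k (2 * H) st (downset x th)) /\
  (forall th, evenly (fun y => l y %% k)%N k (2 * H) st (upset x th)).
Proof.
move=> k0 /forallP g.
have cE X j : #|X :&: bin (fun y => l y %% k)%N (active st) j| =
    class_card k j (X :&: active st) l.
  by apply: eq_card => y; rewrite !inE andbA.
have bal X j j' : balanced k j H (X :&: active st) l ->
    balanced k j' H (X :&: active st) l ->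
    (#|X :&: bin (fun y => l y %% k)%N (active st) j| <=
     #|X :&: bin (fun y => l y %% k)%N (active st) j'| + 2 * H)%N.
  rewrite !cE => /andP[le1 _] /andP[_ le2].
  rewrite -(leq_pmul2l k0) !mulnDr; lia.
split=> th j j' jk j'k.
  have /andP[g1 _] := g (th, Ordinal jk); have /andP[g2 _] := g (th, Ordinal j'k).
  exact: bal g1 g2.
have /andP[_ g1] := g (th, Ordinal jk); have /andP[_ g2] := g (th, Ordinal j'k).
exact: bal g1 g2.
Qed.

Lemma good_bin_card (D : nat) (S : {set 'I_n}) (l : {ffun 'I_n -> 'I_M}) (j : nat) :
  (j < k)%N -> (0 < n)%N -> (H <= D)%N -> (#|S| <= 2 * D * k)%N -> good S l ->
  (#|bin (fun y => l y %% k)%N S j| <= 3 * D)%N.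
Proof.
move=> jk n0 HD SD /forallP g.
have [th _ thmax] := @arg_maxP _ _ _ (Ordinal n0) predT x isT.
have /andP[/andP[le _] _] := g (th, Ordinal jk).
have dT : downset x th :&: S = S.
  by apply/setP => y; rewrite !inE (thmax y isT : x y <= x th).
move: le; rewrite dT /= => le.
have k0 : (0 < k)%N by apply: leq_ltn_trans jk.
have -> : #|bin (fun y => l y %% k)%N S j| = class_card k j S l.
  by apply: eq_card => y; rewrite !inE.
rewrite -(leq_pmul2l k0); apply: leq_trans le _.
by apply: leq_trans (leq_add SD (leq_mul (leqnn k) HD)) _; lia.
Qed.

End Good.

(** * The algorithm, its runs and its failure probability *)

Section Algorithm.
Variables (R : realType) (n : nat) (i : 'I_n) (T M : nat) (k : nat -> nat) (e b : nat).
Hypothesis M0 : (0 < M)%N.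

Let labels : finType := {ffun 'I_n -> 'I_M}.
(** The index type ['I_T.+1] is inhabited even for [T = 0], as [inord] requires. *)
Let seeds : finType := {ffun 'I_T.+1 -> {ffun 'I_n -> 'I_M}}.

Definition label (w : seeds) (t : nat) (y : 'I_n) : nat := (w (inord t) y %% k t)%N.

Definition round_queries (w : seeds) (t : nat) (st : state n) : {set comparison n} :=
  step_queries (label w t) (active st).

(* A round whose random partition is too unbalanced for the budget [b] is
   skipped, so that the number of comparisons is bounded for every seed. *)
Definition advance (w : seeds) (ts : nat * state n) (r : round_answers n) :=
  (ts.1.+1, if (#|round_queries w ts.1 ts.2| <= b)%N
            then step i (label w ts.1) e (beat r) ts.2 else ts.2).

Definition alg_state (w : seeds) (h : history n) : nat * state n :=
  foldl (advance w) (0%N, init_state n) h.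

Definition alg_query (w : seeds) (h : history n) : {set comparison n} :=
  let ts := alg_state w h in
  let Q := round_queries w ts.1 ts.2 in if (#|Q| <= b)%N then Q else set0.

Definition alg_output (w : seeds) (h : history n) : 'I_n :=
  select i (alg_state w h).2.

Lemma card_seeds_gt0 : (0 < #|seeds|)%N.
Proof. by rewrite !card_ffun !card_ord !expn_gt0 M0. Qed.

Lemma uniform_ge0 (w : seeds) : 0 <= #|seeds|%:R^-1 :> R.
Proof. by rewrite invr_ge0. Qed.

Lemma uniform_sum1 : \sum_(w : seeds) #|seeds|%:R^-1 = 1 :> R.
Proof.
rewrite sumr_const -[LHS]mulr_natr mulVf //.
by rewrite pnatr_eq0 -lt0n card_seeds_gt0.
Qed.

Definition alg : rand_algorithm R n :=
  RandAlgorithm uniform_ge0 uniform_sum1 T alg_query alg_output.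

Lemma alg_state_rcons w h r :
  alg_state w (rcons h r) = advance w (alg_state w h) r.
Proof. exact: foldl_rcons. Qed.

Lemma alg_state_size w h : (alg_state w h).1 = size h.
Proof.
by elim/last_ind: h => // h r IH; rewrite alg_state_rcons size_rcons /= IH.
Qed.

Lemma num_comparisons_alg x adv (w : seed alg) :
  (num_comparisons x adv w <= T * b)%N.
Proof.
apply: (@leq_trans (\sum_(t < T) b)); last first.
  by rewrite big_const_ord iter_addn addn0 mulnC.
by apply: leq_sum => t _; rewrite /= /alg_query; case: ifP; rewrite ?cards0.
Qed.

Section Runs.
Variables (x : 'I_n -> R) (adv : adversary n).

Definition run_state (w : seeds) (t : nat) : state n :=
  (alg_state w (@run R n alg x adv w t)).2.

Lemma size_run (w : seeds) t : size (@run R n alg x adv w t) = t.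
Proof. by elim: t => //= t IH; rewrite size_rcons IH. Qed.

(** Coordinate [t] of the seed is first read in round [t], and the adversary sees only the history
    and the queries, so nothing earlier depends on it. *)
Lemma run_resample (w : seeds) (t : 'I_T.+1) l s : (s <= t)%N ->
  alg_state (resample w t l) (@run R n alg x adv (resample w t l) s) =
    alg_state w (@run R n alg x adv w s) /\
  @run R n alg x adv (resample w t l) s = @run R n alg x adv w s.
Proof.
elim: s => [//|s IH] st; have [IHs IHr] := IH (ltnW st).
have ws : label (resample w t l) s = label w s.
  rewrite /label resample_other //; apply/eqP => /(congr1 val) /=.
  by rewrite inordK => [ts|]; [rewrite ts ltnn in st | exact: ltn_trans st (ltn_ord t)].
have qE : alg_query (resample w t l) (@run R n alg x adv (resample w t l) s) =
    alg_query w (@run R n alg x adv w s).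
  by rewrite /alg_query IHs /round_queries !alg_state_size size_run ws.
split; last by rewrite /= qE IHr.
rewrite /= qE IHr !alg_state_rcons; rewrite IHr in IHs.
by rewrite IHs /advance /round_queries alg_state_size size_run ws.
Qed.

Lemma run_state_resample (w : seeds) (t : 'I_T.+1) l :
  run_state (resample w t l) t = run_state w t.
Proof. by rewrite /run_state; have [-> _] := run_resample w l (leqnn t). Qed.

Lemma run_stateS (w : seeds) t :
  let st := run_state w t in
  run_state w t.+1 =
  if (#|round_queries w t st| <= b)%N then
    step i (label w t) e
      (beat (answer x adv (@run R n alg x adv w t) (round_queries w t st))) st
  else st.
Proof.
rewrite /run_state /= alg_state_rcons /advance /=.
rewrite /alg_query /= alg_state_size size_run.
by case: ifP => // le_b; rewrite ifT.
Qed.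

Variables (v : R) (H D : nat) (N : nat -> nat).
Hypotheses
  (rank_le : forall (E : {set 'I_n}) (th : R), (i < #|E|)%N ->
     {in E, forall y, x y <= th} -> v <= th)
  (rank_ge : forall (E : {set 'I_n}) (th : R), (n <= #|E| + i)%N ->
     {in E, forall y, th <= x y} -> th <= v).
Hypotheses (eH : e = (2 * H)%N) (bD : b = (3 * (3 * D) * n)%N) (HD : (H <= D)%N)
  (k_gt0 : forall t, (0 < k t)%N) (N0 : N 0 = n)
  (NDk : forall t, (N t <= 2 * D * k t)%N)
  (Nshrink : forall t, k t = 1%N \/ (46 * H * k t <= N t.+1)%N).

(** The implication spares conditioning on earlier rounds: the tail bound needs a size bound on the
    undecided set, and larger sets count as good. *)
Definition good_round (w : seeds) (t : nat) : bool :=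
  (#|active (run_state w t)| <= N t)%N ==>
  good x (k t) H (active (run_state w t)) (w (inord t)).

(** Squeezed states stay squeezed. Until then a good round fits the budget, so it is played and
    shrinks the undecided set. *)
Lemma run_invariant (w : seeds) t : (forall s, (s < t)%N -> good_round w s) ->
  valid x v (run_state w t) /\
  (squeezed x (run_state w t) \/
   safe x (run_state w t) /\ (#|active (run_state w t)| <= N t)%N).
Proof.
elim: t => [_|t IH gw].
  split; first by split=> [p|p|p y|a c]; rewrite /= ?setU0 inE.
  right; split; last by rewrite N0 -[X in (_ <= X)%N]card_ord max_card.
  by split=> y; rewrite ?inE //= !inE.
have [vst inv] := IH (fun s st => gw s (ltnW st)).
have lab_lt y : (label w t y < k t)%N by rewrite ltn_mod.
move: (run_stateS w t) vst inv (gw t (leqnn _)); rewrite /good_round /=.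
move: (run_state w t) (run_state w t.+1) => st st' ->.
set Q := round_queries w t st; set h := run _ _ _ _.
set B := beat _ => vst inv gt.
have Bsound a c : B a c -> x c - 1 <= x a by exact: beat_sound.
have Basym a c : B a c -> ~~ B c a by exact: beat_asym.
have Bpivot p y : p \in bin (label w t) (active st) 0 -> p != y -> B p y || B y p.
  by move=> pP py; apply: beat_total => //; apply: canon_queries_pivot.
have Btotal : {in active st &, forall a c, a != c -> label w t a = label w t c ->
    B a c || B c a}.
  by move=> a c aS cS ac lac; apply: beat_total => //; apply: canon_queries_group.
split.
  by case: ifP => _ //; apply: step_valid.
case: inv => [sq|[sst Sle]].
  by left; case: ifP => _ //; apply: squeezed_step.
rewrite Sle /= in gt; have SD := leq_trans Sle (NDk t).
have binle j : (j < k t)%N -> (#|bin (label w t) (active st) j| <= 3 * D)%N.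
  by move=> jk; apply: (good_bin_card jk _ HD SD gt); apply: leq_ltn_trans (ltn_ord i).
have -> : (#|Q| <= b)%N.
  by rewrite bD; apply: card_step_queries => [y|]; apply: binle.
have [evd evu] := good_evenly (k_gt0 t) gt; rewrite -eH in evd evu.
have [sq|nsq] := boolP (squeezed x (step i (label w t) e B st)); [by left|right].
split; first exact: (step_safe i Bsound lab_lt evd evu Btotal sst).
case: (Nshrink t) => [k1|]; first by rewrite (step_one_group _ _ _ _ lab_lt k1) cards0.
apply: leq_trans; apply: leq_trans (survivors_card lab_lt evd evu Bsound Basym nsq) _.
by rewrite eH; lia.
Qed.

Lemma result_near (w : seeds) : N T = 0%N ->
  (forall t : 'I_T.+1, good_round w t) -> `|x (@result R n alg x adv w) - v| <= 4%:R.
Proof.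
move=> NT gw; have [|vst inv] := @run_invariant w T.
  by move=> s sT; have := gw (inord s); rewrite inordK // ltnW.
apply: (select_near rank_le rank_ge vst); case: inv => [|[sst]]; [by left|right].
by split=> //; apply/eqP; rewrite -cards_eq0 -leqn0 -NT.
Qed.

(** Union bound over the rounds; the state before round [t] ignores coordinate [t], so that
    coordinate may be resampled. *)
Lemma bad_rounds_card : (forall t, (k t <= n)%N) -> (forall t, (k t %| M)%N) -> (0 < D)%N ->
  #|[set w : seeds | [exists t : 'I_T.+1, ~~ good_round w t]]|%:R <=
  T.+1%:R * (4%:R * n%:R ^+ 2 * expR (- (H%:R ^+ 2 / (16%:R * D%:R)))) * #|seeds|%:R :> R.
Proof.
move=> kn kM D0; set bd := 4%:R * _ * _.
have bd0 : 0 <= bd by rewrite mulr_ge0 ?expR_ge0 // mulr_ge0 // exprn_ge0.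
apply: (@le_trans _ _ (\sum_(t < T.+1) bd * #|seeds|%:R)); last first.
  by rewrite sumr_const card_ord -[leLHS]mulr_natr mulrC mulrA.
apply: (@le_trans _ _ (\sum_(t < T.+1) #|[set w : seeds | ~~ good_round w t]|%:R)).
  by rewrite -natr_sum ler_nat card_exists_le.
apply: ler_sum => t _.
pose E (w : seeds) : pred labels := fun l =>
  ~~ ((#|active (run_state w t)| <= N t)%N ==> good x (k t) H (active (run_state w t)) l).
have -> : [set w : seeds | ~~ good_round w t] = [set w | E w (w t)].
  by apply/setP => w; rewrite !inE /E /good_round inord_val.
apply: resample_card => [w l l'|w].
  by rewrite /E run_state_resample.
rewrite /E; case: leqP => [Sle|_] /=; last first.
  by rewrite eq_card0 ?(mulr_ge0 bd0) // => l; rewrite !inE.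
by apply: not_good_card; rewrite ?k_gt0 ?kn //; apply: leq_trans Sle (NDk t).
Qed.

Lemma Pr_alg_ge (P : pred seeds) (c : R) :
  #|[set w | ~~ P w]|%:R <= c * #|seeds|%:R -> 1 - c <= Pr (A := alg) P.
Proof.
have s0 : (0 : R) < #|seeds|%:R by rewrite ltr0n card_seeds_gt0.
move=> le; rewrite /Pr /= sumr_const -[leRHS]mulr_natr mulrC ler_pdivlMr //.
have -> : #|P|%:R = #|seeds|%:R - #|[set w | ~~ P w]|%:R :> R.
  apply/eqP; rewrite eq_sym subr_eq -natrD; apply/eqP; congr (_%:R).
  rewrite -(cardC P); congr (_ + _)%N; apply: eq_card => w.
  by rewrite !inE.
by rewrite mulrBl mul1r lerD2l lerN2.
Qed.

End Runs.
End Algorithm.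

(** * Numerical estimates for the parameters *)

Section ParameterChoice.
Variables (R : realType) (n d : nat).
Hypotheses (n2 : (1 < n)%N) (d2 : (1 < d)%N).

Let L := (trunc_log 2 n).+1.

Let n_lt : (n < 2 ^ L)%N.
Proof. exact: trunc_log_ltn. Qed.

Let n_ge : (2 ^ L.-1 <= n)%N.
Proof. by apply: trunc_logP => //; apply: ltnW. Qed.

Let L_gt1 : (1 < L)%N.
Proof.
rewrite ltnNge; apply/negP => L1; move: n_lt.
have -> : L = 1%N by apply/eqP; rewrite eqn_leq L1.
by rewrite expn1 ltnNge n2.
Qed.

Lemma log_le : (L <= n)%N.
Proof. by apply: leq_trans n_ge; rewrite -{1}(ltn_predK L_gt1) ltn_expl. Qed.

(** [exp (1/2) <= 2] turns [2 ^ L.-1 <= n] into [L.-1 / 2 <= ln n], and [L <= 2 L.-1]. *)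
Lemma log_le_ln : L%:R <= 4%:R * ln (n%:R : R).
Proof.
have n0 : (0 : R) < n%:R by rewrite ltr0n ltnW.
have half : expR (2%:R^-1 : R) <= 2%:R.
  by apply: le_trans (expR_quad (lexx _)) _; lra.
have : expR (2%:R^-1 * (L.-1)%:R) <= expR (ln (n%:R : R)).
  rewrite lnK ?posrE // expRM_natr; apply: (@le_trans _ _ (2%:R ^+ L.-1)).
    by rewrite lerXn2r ?nnegrE ?expR_ge0.
  by rewrite -natrX ler_nat.
have : (L%:R : R) <= 2%:R * (L.-1)%:R by rewrite -natrM ler_nat; lia.
rewrite ler_expR; lra.
Qed.

(* Either [m = 2] and the number of rounds is logarithmic in [n], or [m] is
   about [n^(1/d)]. *)
Lemma shrink_factor_exists : exists m : nat,
  [/\ (1 < m)%N, (n < m ^ minn d L)%N &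
      (m = 2 /\ (L <= d)%N) \/
      [/\ (d < L)%N, (2 ^ d <= n)%N & (m.-1 ^ d <= n)%N]].
Proof.
have [Ld|dL] := leqP L d; first by exists 2; split => //; left.
have ex : exists m, (n < m ^ d)%N.
  exists n.+1; apply: leq_trans (_ : n.+1 ^ 1 <= _)%N; first by rewrite expn1.
  by rewrite leq_pexp2l // ltnW.
have dn : (2 ^ d <= n)%N by apply: leq_trans n_ge; rewrite leq_pexp2l //; lia.
have [m mlt mmin] := ex_minnP ex; exists m.
have m1 : (1 < m)%N.
  rewrite -(ltn_exp2r _ _ (ltnW d2)) exp1n; lia.
split=> //; right; split=> //; rewrite leqNgt; apply/negP => /mmin; lia.
Qed.

(** With [y = ln n / d]: for [m = 2] the linear bound on [exp] absorbs [9 * 4 * 16 = 576] times [c].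
    Otherwise [exp y >= 2], so [exp (576 c y)] absorbs [576 c], and the extra 2 in the exponent pays
    for [m ^ 2]. *)
Lemma cost_le (c m : nat) :
  (m = 2 /\ (L <= d)%N) \/ [/\ (d < L)%N, (2 ^ d <= n)%N & (m.-1 ^ d <= n)%N] ->
  (1 < m)%N ->
  (minn d L * (9 * (c * m ^ 2 * L) * n))%:R <=
  (n%:R : R) `^ (1 + (576 * c + 2)%:R / d%:R) * d%:R * ln (n%:R : R).
Proof.
move=> cases m1; have n0 : (0 : R) < n%:R by rewrite ltr0n ltnW.
have d0 : (0 : R) < d%:R by rewrite ltr0n ltnW.
have LL := log_le_ln; set l := ln (n%:R : R) in LL *.
have L0 : (0 : R) <= L%:R by [].
have c0 : (0 : R) <= c%:R by [].
pose y : R := l / d%:R.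
have -> : (n%:R : R) `^ (1 + (576 * c + 2)%:R / d%:R) =
    n%:R * expR (y * (576 * c + 2)%:R).
  rewrite /powR gt_eqF // mulrDl mul1r expRD lnK ?posrE //; congr (_ * expR _).
  by rewrite /y -/l [RHS]mulrC mulrA mulrAC.
suff le : (minn d L)%:R * (9%:R * (c%:R * m%:R ^+ 2 * L%:R)) <=
    expR (y * (576 * c + 2)%:R) * d%:R * l.
  rewrite [leLHS](_ : _ = n%:R * ((minn d L)%:R * (9%:R * (c%:R * m%:R ^+ 2 * L%:R)))).
    by rewrite -2![n%:R * _ * _]mulrA ler_wpM2l // ltW.
  by rewrite !natrM; ring.
case: cases => [[-> Ld]|[dL dn mn]].
  have -> : minn d L = L by apply/minn_idPr.
  have e1 := expR_ge1Dx (y * (576 * c + 2)%:R).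
  have yd : y * d%:R = l by rewrite /y divfK // gt_eqF.
  have : (576%:R * c%:R) * l <= expR (y * (576 * c + 2)%:R) * d%:R.
    have : (1 + y * (576 * c + 2)%:R) * d%:R <= expR (y * (576 * c + 2)%:R) * d%:R.
      by rewrite ler_wpM2r // ltW.
    apply: le_trans.
    have -> : (1 + y * (576 * c + 2)%:R) * d%:R = d%:R + y * d%:R * (576 * c + 2)%:R.
      by ring.
    by rewrite yd natrD natrM; lra.
  have l0 : 0 <= l by lra.
  move=> /(ler_wpM2r l0); apply: le_trans.
  have : L%:R * L%:R <= (4%:R * l) * (4%:R * l) by apply: ler_pM.
  move=> /(ler_wpM2l c0); nra.
have -> : minn d L = d by apply/minn_idPl/ltnW.
have l0 : 0 <= l by lra.
have yX : expR y ^+ d = n%:R.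
  by rewrite -expRM_natr /y divfK ?gt_eqF // lnK.
have root p : (p ^ d <= n)%N -> p%:R <= expR y.
  move=> pn; rewrite -(@ler_pXn2r _ d) ?nnegrE ?expR_ge0 ?(ltnW d2) //.
  by rewrite yX -natrX ler_nat.
have y2 := root _ dn; have ym := root _ mn.
have m2 : m%:R <= 2%:R * expR y.
  apply: le_trans (_ : 2%:R * m.-1%:R <= _); last by rewrite ler_wpM2l.
  by rewrite -natrM ler_nat; lia.
have mm : m%:R ^+ 2 <= 4%:R * expR y ^+ 2.
  rewrite (_ : 4%:R * _ = (2%:R * expR y) ^+ 2); last by ring.
  by rewrite lerXn2r ?nnegrE ?mulr_ge0 ?expR_ge0.
have ec : (576%:R * c%:R) <= expR y ^+ (576 * c).
  apply: (@le_trans _ _ (2%:R ^+ (576 * c))).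
    by rewrite -natrM -natrX ler_nat ltnW // ltn_expl.
  by rewrite lerXn2r ?nnegrE ?expR_ge0.
rewrite expRM_natr exprD.
move: ec mm; move: (expR y ^+ (576 * c)) (expR y ^+ 2) (sqr_ge0 (expR y)) => E1 E2 E20 ec mm.
have h1 : c%:R * m%:R ^+ 2 * L%:R <= c%:R * (4%:R * E2) * (4%:R * l).
  apply: ler_pM => //; first by rewrite mulr_ge0 ?sqr_ge0.
  by rewrite ler_wpM2l.
have h2 : 9%:R * (c%:R * (4%:R * E2) * (4%:R * l)) <= E1 * E2 * l.
  have : (576%:R * c%:R) * (E2 * l) <= E1 * (E2 * l) by rewrite ler_wpM2r // mulr_ge0.
  have : 0 <= c%:R * (E2 * l) by rewrite mulr_ge0 // mulr_ge0.
  lra.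
have : d%:R * (9%:R * (c%:R * m%:R ^+ 2 * L%:R)) <= d%:R * (E1 * E2 * l).
  by apply: ler_wpM2l; [exact: ltW | lra].
lra.
Qed.

(** [exp (8 L)] exceeds [n ^ 8], while [T + 1 <= 2 n] leaves [2 ^ 3 * n ^ 5 <= n ^ 8] to beat, where
    [T = minn d L]. *)
Lemma failure_lt :
  (minn d L).+1%:R * (4%:R * n%:R ^+ 2 * expR (- (8%:R * L%:R))) < 1 / n%:R ^+ 2 :> R.
Proof.
have n0 : (0 : R) < n%:R by rewrite ltr0n ltnW.
have nR2 : (2%:R : R) <= n%:R by rewrite ler_nat.
have e8 : n%:R ^+ 8 < expR (8%:R * L%:R) :> R.
  apply: (@lt_le_trans _ _ ((2%:R ^+ L) ^+ 8)).
    by rewrite ltrXn2r ?nnegrE // -?natrX ?ltr_nat ?ler0n.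
  rewrite mulrC expRM_natr lerXn2r ?nnegrE ?exprn_ge0 ?expR_ge0 //.
  rewrite -[X in expR X]mul1r expRM_natr lerXn2r ?nnegrE ?expR_ge0 //.
  by have := expR_ge1Dx (1 : R); lra.
rewrite expRN ltr_pdivlMr ?exprn_gt0 //.
rewrite [ltLHS](_ : _ = (minn d L).+1%:R * (4%:R * n%:R ^+ 2 * n%:R ^+ 2)
  / expR (8%:R * L%:R)); last first.
  by move: (expR _)^-1 (_.+1%:R) => *; ring.
rewrite ltr_pdivrMr ?expR_gt0 // mul1r; apply: le_lt_trans e8.
have T1 : ((minn d L).+1%:R : R) <= 2%:R * n%:R.
  by rewrite -natrM ler_nat; have := log_le; have := geq_minr d L; lia.
apply: (@le_trans _ _ (2%:R * n%:R * (4%:R * n%:R ^+ 2 * n%:R ^+ 2))).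
  by apply: ler_wpM2r T1; rewrite -mulrA -exprD mulr_ge0 // exprn_ge0 // ltW.
have -> : 2%:R * n%:R * (4%:R * n%:R ^+ 2 * n%:R ^+ 2) = 2%:R ^+ 3 * n%:R ^+ 5 :> R by ring.
rewrite (_ : 8 = 3 + 5)%N // exprD; apply: ler_wpM2r; first by rewrite exprn_ge0 // ltW.
by rewrite lerXn2r ?nnegrE.
Qed.

End ParameterChoice.

(** * Assembling the algorithm *)

Lemma singleton_case (R : realType) (i : 'I_1) : exists A : rand_algorithm R 1,
  [/\ rounds A = 0%N,
      forall (x : 'I_1 -> R) (adv : adversary 1) (w : seed A),
        num_comparisons x adv w = 0%N
    & forall (x : 'I_1 -> R) (adv : adversary 1),
        1 <= Pr (fun w : seed A => approx_selection 202%:R x i (result x adv w))].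
Proof.
(* As [ln 1 = 0], no comparison is allowed: zero rounds and zero budget. *)
exists (alg R i 0 (fun=> 1%N) 0 0 (ltn0Sn 0)); split=> // x adv.
  by move=> w; apply/eqP; rewrite -leqn0 num_comparisons_alg.
rewrite -[leLHS]subr0; apply: Pr_alg_ge; rewrite mul0r eq_card0 // => w.
rewrite !inE; apply/negbTE/negPn/existsP; exists 1%g.
rewrite perm1 [i]ord1 [result _ _ _]ord1 eqxx andbT.
by apply/forallP => a; apply/forallP => b; rewrite [a]ord1 [b]ord1.
Qed.

Lemma selection_alg (R : realType) (d n : nat) (i : 'I_n) : (1 < d)%N -> (1 < n)%N ->
  exists A : rand_algorithm R n,
    [/\ (rounds A <= d)%N,
        forall (x : 'I_n -> R) (adv : adversary n) (w : seed A),
          (num_comparisons x adv w)%:R <=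
          (n%:R : R) `^ (1 + (576 * (46 * (8 * 736)) + 2)%:R / d%:R)
            * d%:R * ln (n%:R : R)
      & forall (x : 'I_n -> R) (adv : adversary n),
          1 - 1 / (n%:R ^+ 2) <
          Pr (fun w : seed A => approx_selection 202%:R x i (result x adv w))].
Proof.
move=> d2 n2; have n0 : (0 < n)%N := ltnW n2.
have [m [m1 nm mcases]] := shrink_factor_exists n2 d2.
have cost := @cost_le R n d n2 d2 (46 * (8 * 736)) m mcases m1.
have fail := @failure_lt R n d n2 d2.
move: nm cost fail; set L := (trunc_log 2 n).+1; set T := minn d L.
move=> nm cost fail.
have m0 : (0 < m)%N := ltnW m1.
(* The exponent [H^2 / (16 D)] equals [h0 L / 736] with [736 = 16 * 46], so this value makes it
   [8 L]. The equation keeps the numeral opaque. *)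
have [h0 h0E] : exists h, h = (8 * 736)%N by eexists.
rewrite -h0E in cost *.
have h0_gt0 : (0 < h0)%N by rewrite h0E.
(* At most [23 (2 H) k = 46 H k] items survive, which for [k <= N t / D] is at most [N t / m]. *)
pose H := (h0 * m * L)%N; pose D := (46 * H * m)%N.
pose N t := (n %/ m ^ t)%N; pose k t := maxn 1 (N t %/ D).
have H0 : (0 < H)%N by rewrite !muln_gt0 h0_gt0 m0.
have D0 : (0 < D)%N by rewrite 2!muln_gt0 H0 m0.
have HD : (H <= D)%N by rewrite /D; nia.
(* Taking [M] to be the factorial of [n] makes it divisible by every possible number of bins. *)
have M0 := fact_gt0 n.
have Nn t : (N t <= n)%N by exact: leq_div.
have k_gt0 t : (0 < k t)%N by rewrite /k; lia.
have kn t : (k t <= n)%N.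
  by rewrite geq_max n0; apply: leq_trans (leq_div _ _) (Nn t).
have kM t : (k t %| n`!)%N by apply: dvdn_fact; rewrite k_gt0 kn.
have NDk t : (N t <= 2 * D * k t)%N.
  have := ltn_ceil (N t) D0; rewrite /k; move: (N t %/ D)%N => q; nia.
have Nshrink t : k t = 1%N \/ (46 * H * k t <= N t.+1)%N.
  have [q1|q1] := leqP (N t %/ D) 1; first by left; rewrite /k; lia.
  right; rewrite /k (maxn_idPr (ltnW q1)) /N expnSr divnMA leq_divRL //.
  by rewrite -/(N t) mulnAC -/D mulnC leq_trunc_div.
have N0 : N 0%N = n by rewrite /N expn0 divn1.
have NT : N T = 0%N by rewrite /N divn_small.
exists (alg R i T k (2 * H) (3 * (3 * D) * n) M0); split.
- exact: geq_minl.
- move=> x adv w; apply: le_trans cost; rewrite ler_nat.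
  apply: leq_trans (num_comparisons_alg _ _ _) _.
  by rewrite leq_mul2l; apply/orP; right; rewrite /D /H; nia.
- move=> x adv; have [v [rank_le rank_ge near]] := order_statistic_exists x i.
  have := @bad_rounds_card R n i T n`! k (2 * H) (3 * (3 * D) * n) M0 x adv H D N
    HD k_gt0 NDk kn kM D0.
  have -> : H%:R ^+ 2 / (16%:R * D%:R) = 8%:R * L%:R :> R.
    have HE : H%:R = 8%:R * 736%:R * m%:R * L%:R :> R by rewrite /H h0E !natrM.
    have DE : D%:R = 46%:R * H%:R * m%:R :> R by rewrite -!natrM.
    have m0R : m%:R != 0 :> R by rewrite pnatr_eq0 -lt0n.
    have L0R : L%:R != 0 :> R by rewrite pnatr_eq0.
    rewrite DE HE; move: (m%:R : R) (L%:R : R) m0R L0R => a c a0 c0.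
    by field; rewrite a0 c0.
  set c := _ * (_ * _) => bad.
  apply: lt_le_trans (@Pr_alg_ge R n i T n`! k (2 * H) (3 * (3 * D) * n) M0 _ c _).
    by rewrite ltrD2l ltrN2.
  apply: le_trans bad; rewrite ler_nat; apply/subset_leq_card/subsetP => w.
  rewrite !inE; apply: contraR; rewrite negb_exists => /forallP gw.
  apply: near; apply: (result_near rank_le rank_ge erefl erefl HD k_gt0 N0 NDk Nshrink NT).
  by move=> t; have := gw t; rewrite negbK.
Qed.

Theorem theorem1p9 (R : realType) :
  exists C : R, forall (d n : nat) (i : 'I_n), (1 < d)%N ->
  exists A : rand_algorithm R n,
    [/\ (rounds A)%:R <= d%:R + C * ln (d%:R : R),
        forall (x : 'I_n -> R) (adv : adversary n) (w : seed A),
          (num_comparisons x adv w)%:R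
            <= (n%:R : R) `^ (1 + C / d%:R) * d%:R * ln (n%:R : R)
      & forall (x : 'I_n -> R) (adv : adversary n),
          1 - 1 / (n%:R ^+ 2)
            < Pr (fun w : seed A =>
                    approx_selection 202%:R x i (result x adv w))].
Proof.
exists (576 * (46 * (8 * 736)) + 2)%:R => d n i d2.
(* The algorithm uses at most [d] rounds, so nonnegativity of the logarithmic term suffices. *)
have Cln : 0 <= (576 * (46 * (8 * 736)) + 2)%:R * ln (d%:R : R).
  by rewrite mulr_ge0 // ln_ge0 // ler1n ltnW.
case: n i => [[]//|[|n]] i.
  have [A [r0 c0 p1]] := singleton_case R i; exists A; split=> [|x adv w|x adv].
  - by rewrite r0 addr_ge0.
  - by rewrite c0 ln1 mulr0.
  - by apply: lt_le_trans (p1 x adv); rewrite expr1n divr1 subrr ltr01.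
have [//|A [rd cA pA]] := @selection_alg R d n.+2 i d2; exists A; split=> //.
by apply: ler_wpDr; rewrite // ler_nat.
Qed.
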